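(* Let $\Phi$ be a Markovian cocycle on a Polish space $\mathbb{X}$ over a filtered dynamical system $(\Omega,\mathcal{F},P,(\theta_t)_{t\in\mathbb{R}},(\mathcal{F}_s^t)_{s\le t})$, with Markovian semigroup $(P_t)_{t\ge0}$, and let $Y$ be an adapted random periodic path of $\Phi$ of period $\tau>0$. Let $\rho_s$ be the law of $Y(s,\cdot)$, $s\in\mathbb{R}$. If the $\tau$-periodic measure $\{\rho_s\}_{s\in\mathbb{R}}$ is PS-ergodic, then for any given $s\in\mathbb{R}$ and $\Gamma\in\mathcal{I}_s^\tau$, either for $P$-almost all $\omega$, $L_s^\omega\cap\Gamma=\emptyset$, or for $P$-almost all $\omega$, $L_s^\omega\subseteq\Gamma$.
   Context: Setting. $(\Omega,\mathcal{F},P)$ is a probability space; $\theta:\mathbb{R}\times\Omega\to\Omega$ is jointly measurable with $\theta_0=\mathrm{id}$, $\theta_t\circ\theta_s=\theta_{t+s}$, $\theta_tP=P$. $\Phi:\mathbb{R}^+\times\Omega\times\mathbb{X}\to\mathbb{X}$ is measurable and, almost surely, $\Phi(0,\omega)=\mathrm{id}$, $\Phi(t+s,\omega)=\Phi(t,\theta_s\omega)\circ\Phi(s,\omega)$ for $t,s\ge0$. The $\sigma$-algebras $\mathcal{F}_s^t\subset\mathcal{F}$ $(s\le t)$ satisfy $\theta_u^{-1}\mathcal{F}_s^t=\mathcal{F}_{s+u}^{t+u}$, and $\Phi(t,\cdot)$ is $\mathcal{F}_0^t$-measurable for $t\ge0$. $\Phi$ is Markovian: $\Phi(t,\cdot)x$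 is a Markov process with transition probability $P_t(x,\Gamma)=P(\{\omega:\Phi(t,\omega)x\in\Gamma\})$, semigroup $(P_t\varphi)(x)=\int_{\mathbb{X}}P_t(x,dy)\varphi(y)$ on bounded Borel functions, and $P_t^*\rho(\Gamma)=\int_{\mathbb{X}}P_t(x,\Gamma)\rho(dx)$ on probability measures. Random periodic path of period $\tau$: a measurable $Y:\mathbb{R}\times\Omega\to\mathbb{X}$ such that for almost all $\omega$, $\Phi(t,\theta_s\omega)Y(s,\omega)=Y(t+s,\omega)$ and $Y(s+\tau,\omega)=Y(s,\theta_\tau\omega)$ for all $t\ge0,s\in\mathbb{R}$. Adapted: $Y(s,\cdot)$ is measurable with respect to $\mathcal{F}_{-\infty}^s=\bigvee_{r\le s}\mathcal{F}_r^s$ for each $s$. The laws $\rho_s(\Gamma)=P(\{\omega:Y(s,\omega)\in\Gamma\})$ form a periodic measure of $(P_t)$ (known result, part of the setting): $P_t^*\rho_s=\rho_{s+t}$ and $\rho_{s+\tau}=\rho_s$ for all $s\in\mathbb{R},t\ge0$. Consequently each $\rho_s$ is invariant for $(P_{k\tau})_{k\in\mathbb{N}}$. Notation. $L_s^\omega=\{Y(s+k\tau,\omega):k\in\mathbb{Z}\}$; $\mathcal{I}_s^\tau=\{\Gamma\in\mathcal{B}(\mathbb{X}):P_\tau I_\Gamma=I_\Gamma,\ \rho_s\text{-a.s.}\}$. PS-ergodicity. The $\tau$-periodic measure $\{\rho_s\}$ is PS-ergodic if for each $s\in[0,\tau)$, $\rho_s$ is ergodic as an invariant measure of the discrete semigroup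 $(P_{k\tau})_{k\in\mathbb{N}}$, i.e. the associated stationary discrete-time canonical dynamical system (shift on path space with finite-dimensional distributions given by initial law $\rho_s$ and transition kernel $P_\tau$) is ergodic (every invariant set has measure $0$ or $1$); equivalently, $\Gamma\in\mathcal{B}(\mathbb{X})$ and $P_\tau I_\Gamma=I_\Gamma$ $\rho_s$-a.s. imply $\rho_s(\Gamma)\in\{0,1\}$. *)

(* Defs.v *)
From HB Require Import structures.
From mathcomp Require Import all_boot all_order all_algebra.
From mathcomp Require Import all_classical all_reals all_analysis.

Set Implicit Arguments.
Unset Strict Implicit.
Unset Printing Implicit Defensive.

Import Order.TTheory GRing.Theory Num.Theory.
Import numFieldNormedType.Exports.

Local Open Scope classical_set_scope.
Local Open Scope ring_scope.
Local Open Scope ereal_scope.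

Definition polish_space (R : realType) (X : topologicalType) : Prop :=
  (exists2 D : set X, countable D & dense D) /\
  exists dist : X -> X -> R,
    [/\ forall x y, dist x y = 0%R <-> x = y,
        forall x y, dist x y = dist y x,
        forall x y z, (dist x z <= dist x y + dist y z)%R,
        forall x (A : set X), nbhs x A <->
          exists2 e : R, (0 < e)%R & [set y | (dist x y < e)%R] `<=` A
      & forall u : nat -> X,
          (forall e : R, (0 < e)%R -> exists N : nat, forall m n : nat,
             (N <= m)%N -> (N <= n)%N -> (dist (u m) (u n) < e)%R) ->
          exists l : X, u @ \oo --> l].

Notation borel X := (g_sigma_algebraType (@open X)).

Definition coordinate_cylinders {d : measure_display} {T : measurableType d} :
    set (set (nat -> T)) :=
  [set C | exists n : nat, exists2 A : set T,
     measurable A & C = [set w | A (w n)]].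

Notation path_space T := (g_sigma_algebraType (@coordinate_cylinders _ T)).

Definition path_shift {d : measure_display} {T : measurableType d}
  (w : path_space T) : path_space T := fun n => w n.+1.

Section canonical_system.
Context {R : realType} {d : measure_display} {T : measurableType d}.

(* [cylinder_prob p A n x] is the probability that the Markov chain started  *)
(* at x with transition kernel p visits A 0, ..., A n at times 0, ..., n:    *)
(*   1_{A 0}(x) \int_{A 1} p(x, dx_1) ... \int_{A n} p(x_{n-1}, dx_n).       *)
Fixpoint cylinder_prob (p : T -> set T -> \bar R) (A : nat -> set T)
    (n : nat) (x : T) : \bar R :=
  (\1_(A 0%N) x)%:E *
  (if n is m.+1 then
     \int[p x]_y cylinder_prob p (fun i => A i.+1) m y
   else 1).

(* By the pi-lambda theorem at most one Q satisfies this. *)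
Definition canonical_measure (mu : set T -> \bar R) (p : T -> set T -> \bar R)
    (Q : probability (path_space T) R) : Prop :=
  forall (n : nat) (A : nat -> set T), (forall i, measurable (A i)) ->
    Q [set w | forall i : nat, (i <= n)%N -> A i (w i)] =
    \int[mu]_x cylinder_prob p A n x.

Definition measure_preserving {d' : measure_display} {S : measurableType d'}
    (Q : set S -> \bar R) (f : S -> S) : Prop :=
  measurable_fun setT f /\
  forall A : set S, measurable A -> Q (f @^-1` A) = Q A.

Definition ergodic_system {d' : measure_display} {S : measurableType d'}
    (Q : set S -> \bar R) (f : S -> S) : Prop :=
  measure_preserving Q f /\
  forall A : set S, measurable A -> f @^-1` A = A -> Q A = 0 \/ Q A = 1.

Definition ergodic_invariant_measure (mu : set T -> \bar R)
    (p : T -> set T -> \bar R) : Prop :=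
  exists2 Q : probability (path_space T) R,
    canonical_measure mu p Q & ergodic_system Q path_shift.

End canonical_system.

Section random_dynamical_systems.
Context {R : realType} {d : measure_display} {Omega : measurableType d}.
Context {X : ptopologicalType}.
Variable P : probability Omega R.

Definition measurable_flow (theta : R -> Omega -> Omega) : Prop :=
  [/\ measurable_fun setT
        (fun z : measurableTypeR R * Omega => theta z.1 z.2),
      theta 0%R = id,
      forall t s : R, theta (t + s)%R = theta t \o theta s
    & forall t : R, measure_preserving P (theta t)].

(* [F s t] is only meaningful for s <= t. *)
Definition filtered_dynamical_system (theta : R -> Omega -> Omega)
    (F : R -> R -> set (set Omega)) : Prop :=
  [/\ measurable_flow theta,
      forall s t : R, (s <= t)%R -> sigma_algebra setT (F s t),
      forall s t : R, (s <= t)%R -> F s t `<=` measurable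
    & forall u s t : R, (s <= t)%R ->
        preimage_set_system setT (theta u) (F s t) = F (s + u)%R (t + u)%R].

(* The values [Phi t] for t < 0 are irrelevant. *)
Definition cocycle (theta : R -> Omega -> Omega)
    (F : R -> R -> set (set Omega))
    (Phi : R -> Omega -> borel X -> borel X) : Prop :=
  [/\ measurable_fun [set z : measurableTypeR R * Omega * borel X | (0 <= z.1.1 :> R)%R]
        (fun z : measurableTypeR R * Omega * borel X => Phi z.1.1 z.1.2 z.2),
      {ae P, forall w, Phi 0%R w = id /\
        forall t s : R, (0 <= t)%R -> (0 <= s)%R ->
          Phi (t + s)%R w = Phi t (theta s w) \o Phi s w}
    & forall (t : R) (x : borel X) (Gamma : set (borel X)),
        (0 <= t)%R -> measurable Gamma ->
        F 0%R t [set w | Gamma (Phi t w x)]].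

Definition transition (Phi : R -> Omega -> borel X -> borel X) (t : R)
    (x : borel X) : set (borel X) -> \bar R :=
  fun Gamma => P [set w | Gamma (Phi t w x)].

Definition semigroup (Phi : R -> Omega -> borel X -> borel X) (t : R)
    (phi : borel X -> R) (x : borel X) : \bar R :=
  \int[transition Phi t x]_y (phi y)%:E.

Definition dual_semigroup (Phi : R -> Omega -> borel X -> borel X) (t : R)
    (rho : set (borel X) -> \bar R) : set (borel X) -> \bar R :=
  fun Gamma => \int[rho]_x transition Phi t x Gamma.

Definition natural_filtration (xi : R -> Omega -> borel X) (s : R) :
    set (set Omega) :=
  <<s [set A | exists u : R, exists2 Gamma : set (borel X),
         (0 <= u <= s)%R /\ measurable Gamma & A = xi u @^-1` Gamma] >>.

(* P(xi_{s+t} \in Gamma | xi_u, u <= s) = p_t(xi_s, Gamma) almost surely,    *)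
(* the conditional probability being spelled out by its defining property.   *)
Definition markov_process (xi : R -> Omega -> borel X)
    (p : R -> borel X -> set (borel X) -> \bar R) : Prop :=
  forall (s t : R) (Gamma : set (borel X)) (A : set Omega),
    (0 <= s)%R -> (0 <= t)%R -> measurable Gamma -> natural_filtration xi s A ->
    P (A `&` xi (s + t)%R @^-1` Gamma) = \int[P]_(w in A) p t (xi s w) Gamma.

Definition markovian_cocycle (theta : R -> Omega -> Omega)
    (F : R -> R -> set (set Omega))
    (Phi : R -> Omega -> borel X -> borel X) : Prop :=
  cocycle theta F Phi /\
  forall x : borel X,
    markov_process (fun t w => Phi t w x) (transition Phi).

Definition random_periodic_path (theta : R -> Omega -> Omega)
    (Phi : R -> Omega -> borel X -> borel X) (tau : R)
    (Y : R -> Omega -> borel X) : Prop :=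
  measurable_fun setT (fun z : measurableTypeR R * Omega => Y z.1 z.2) /\
  {ae P, forall w,
    (forall t s : R, (0 <= t)%R ->
       Phi t (theta s w) (Y s w) = Y (t + s)%R w) /\
    (forall s : R, Y (s + tau)%R w = Y s (theta tau w))}.

Definition past (F : R -> R -> set (set Omega)) (s : R) : set (set Omega) :=
  <<s \bigcup_(r in [set r : R | (r <= s)%R]) F r s >>.

Definition adapted (F : R -> R -> set (set Omega))
    (Y : R -> Omega -> borel X) : Prop :=
  forall (s : R) (Gamma : set (borel X)), measurable Gamma ->
    past F s (Y s @^-1` Gamma).

Definition law (Y : R -> Omega -> borel X) (s : R) :
    set (borel X) -> \bar R := pushforward P (Y s).

Definition periodic_measure (Phi : R -> Omega -> borel X -> borel X) (tau : R)
    (rho : R -> set (borel X) -> \bar R) : Prop :=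
  forall (s : R) (Gamma : set (borel X)), measurable Gamma ->
    (forall t : R, (0 <= t)%R ->
       dual_semigroup Phi t (rho s) Gamma = rho (s + t)%R Gamma) /\
    rho (s + tau)%R Gamma = rho s Gamma.

Definition PS_ergodic (Phi : R -> Omega -> borel X -> borel X) (tau : R)
    (rho : R -> set (borel X) -> \bar R) : Prop :=
  periodic_measure Phi tau rho /\
  forall s : R, (0 <= s < tau)%R ->
    ergodic_invariant_measure (rho s) (transition Phi tau).

Definition invariant_sets (Phi : R -> Omega -> borel X -> borel X) (tau : R)
    (mu : set (borel X) -> \bar R) : set (set (borel X)) :=
  [set Gamma | measurable Gamma /\
    {ae mu, forall x, semigroup Phi tau \1_Gamma x = (\1_Gamma x)%:E}].

Definition path_orbit (tau : R) (Y : R -> Omega -> borel X) (s : R)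
    (w : Omega) : set (borel X) :=
  [set Y (s + k%:~R * tau)%R w | k in [set: int]].

End random_dynamical_systems.

(* Main.v *)
(** Every [Y (s + k tau)] has law [rho_s], and an orbit is a countable family, so
    it suffices that [rho_s Gamma] is 0 or 1.  By periodicity we may take [s] in
    [[0, tau)].  On path space, [{w_0 \in Gamma}] and [{w_0, w_1 \in Gamma}] both
    have probability [rho_s Gamma] because [P_tau 1_Gamma = 1_Gamma] almost
    surely; hence [{w_0 \in Gamma}] agrees almost surely with all its shifts, thus
    with their limsup, which is exactly shift invariant. *)

Require Import Defs.
From mathcomp Require Import all_boot all_order all_algebra.
From mathcomp Require Import all_classical all_reals all_analysis.
From mathcomp Require Import measurable_realfun.
Import Order.TTheory GRing.Theory Num.Theory.
Import numFieldNormedType.Exports.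
Local Open Scope classical_set_scope.
Local Open Scope ring_scope.

Lemma ae_eq_set_measure {d : measure_display} {T : measurableType d}
    {R : realType} (mu : {measure set T -> \bar R}) (A B : set T) :
  measurable A -> measurable B -> {ae mu, forall x, A x <-> B x} ->
  mu A = mu B.
Proof.
move=> mA mB [N [mN N0 AB]].
(* Adjoining the null set [N] changes neither measure and absorbs every point where [A] and [B]
   disagree. *)
rewrite -(measureU0 mA mN N0) -(measureU0 mB mN N0); congr (mu _).
have ABN x : ~ N x -> (A x <-> B x).
  by move=> nNx; apply: contrapT => nAB; exact/nNx/AB.
by apply/seteqP; split=> x []; try (by right);
  have [|/ABN[? ?]] := pselect (N x); [right|left; tauto|right|left; tauto].
Qed.

Lemma ergodic_system_01 {R : realType} {d : measure_display}
    {S : measurableType d} (Q : probability S R) (f : S -> S) (B : set S) :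
  ergodic_system Q f -> measurable B -> Q (B `&` f @^-1` B) = Q B ->
  Q B = 0%E \/ Q B = 1%E.
Proof.
move=> [[mf Qf] ergQ] mB QBB.
pose F n := iter n f @^-1` B.
have FS n : F n.+1 = f @^-1` F n.
  by apply/funext => x; rewrite /F /preimage/= -iterS iterSr.
have mpre A : measurable A -> measurable (f @^-1` A).
  by move=> mA; rewrite -[_ @^-1` _]setTI; exact: mf.
have mF n : measurable (F n) by elim: n => [//|n IH]; rewrite FS; exact: mpre.
have QF n : Q (F n) = Q B by elim: n => [//|n IH]; rewrite FS Qf.
have QFF n : Q (F n `&` F n.+1) = Q B.
  elim: n => [|n IH]; first by rewrite FS.
  by rewrite (FS n.+1) {1}FS -preimage_setI Qf//; exact: measurableI.
have diff0 A A' : measurable A -> measurable A' ->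
    Q A = Q B -> Q (A `&` A') = Q B -> Q (A `\` A') = 0%E.
  move=> mA mA' QA QAA'; transitivity (Q A - Q (A `&` A'))%E.
    by apply: measureD => //; rewrite -ge0_fin_numE// fin_num_measure.
  by rewrite QA QAA' subee// fin_num_measure.
have D1 n : Q (F n `\` F n.+1) = 0%E by exact: diff0.
have D2 n : Q (F n.+1 `\` F n) = 0%E by apply: diff0; rewrite // setIC.
have mL : measurable (lim_sup_set F).
  by apply: bigcap_measurable => // k _; apply: bigcup_measurable.
have aeF : {ae Q, forall x n, F n x <-> F n.+1 x}.
  apply: ae_foralln => n.
  (* The exceptional set is the symmetric difference of two consecutive preimages, null by [D1] and
     [D2]. *)
  exists ((F n `\` F n.+1) `|` (F n.+1 `\` F n)); split.
  - by apply: measurableU; exact: measurableD.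
  - by apply: etrans (measureU0 _ _ (D2 n)) (D1 n); exact: measurableD.
  - move=> x /= nFF; case: (pselect (F n x)); case: (pselect (F n.+1 x)) => ? ?.
    + by exfalso; apply: nFF.
    + by left.
    + by right.
    + by exfalso; apply: nFF.
have <- : Q (lim_sup_set F) = Q B.
  apply: ae_eq_set_measure => //.
  apply: filterS aeF => x Fx.
  have F0 n : F n x <-> B x.
    elim: n => [|n IH]; first exact: iff_refl.
    exact: iff_trans (iff_sym (Fx n)) IH.
  split=> [/(_ 0%N I)[n _ /F0]//|Bx n _].
  by exists n => //=; apply/F0.
(* Strict invariance is a shift of index. Asking for an index at least [n.+1] forces a successor
   [m.+1], whose predecessor is still at least [n]. *)
apply: ergQ => //; apply/seteqP; split=> x Lx n _.
- have [m /= nm Fm] := Lx n I; exists m.+1; first exact: leqW.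
  by rewrite FS.
- have [[//|m] /= nm] := Lx n.+1 I.
  by rewrite FS => Fm; exists m.
Qed.

(* [p x] is a bare set function, so the sign of its integrals is not automatic. *)
Lemma ergodic_invariant_measure_01 {R : realType} {d : measure_display}
    {T : measurableType d} (mu : {measure set T -> \bar R})
    (p : T -> set T -> \bar R) (B : set T) :
  ergodic_invariant_measure mu p -> measurable B ->
  (forall x, 0 <= \int[p x]_y (\1_B y)%:E)%E ->
  measurable_fun setT (fun x => \int[p x]_y (\1_B y)%:E)%E ->
  {ae mu, forall x, (\int[p x]_y (\1_B y)%:E)%E = (\1_B x)%:E} ->
  mu B = 0%E \/ mu B = 1%E.
Proof.
move=> [Q QE ergQ] mB pB0 mpB pB.
pose C : set (path_space T) := [set w | B (w 0%N)].
have mC : measurable C.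
  by apply: sub_sigma_algebra; exists 0%N, B.
have QC : Q C = mu B.
  have := QE 0%N (fun=> B) (fun=> mB).
  under eq_integral do rewrite /= mule1.
  rewrite integral_indic// setIT => <-; congr (Q _).
  apply/seteqP; split=> w /=; first by move=> ? i; rewrite leqn0 => /eqP ->.
  by apply.
rewrite -QC; apply: (@ergodic_system_01 _ _ _ Q path_shift C ergQ mC).
have -> : C `&` path_shift @^-1` C = [set w | forall i, (i <= 1)%N -> B (w i)].
  apply/seteqP; split=> w /=; first by move=> [? ?] [|[|]].
  by move=> H; split; apply: H.
rewrite QC (QE _ (fun=> B))//.
have cylE x : cylinder_prob p (fun=> B) 1 x =
    ((\1_B x)%:E * \int[p x]_y (\1_B y)%:E)%E.
  rewrite /=; congr (_ * integral _ _ _)%E.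
  by apply/funext => y; rewrite mule1.
(* The two-step cylinder has density [\1_B] times the one-step image of [\1_B]. By invariance this
   is almost everywhere the square of [\1_B], hence [\1_B] itself. *)
transitivity (\int[mu]_x (\1_B x)%:E)%E; last first.
  by rewrite integral_indic// setIT.
under eq_integral do rewrite cylE.
apply: ge0_ae_eq_integral => //.
- by apply: emeasurable_funM => //; exact/measurable_EFinP.
- exact/measurable_EFinP.
- by move=> x _; apply: mule_ge0; rewrite ?lee_fin.
- apply: filterS pB => x -> _.
  by rewrite -EFinM indicE; case: (x \in B); rewrite ?mulr1 ?mulr0.
Qed.

Section cocycle_measurability.
Context {R : realType} {d : measure_display} {Omega : measurableType d}.
Context {X : ptopologicalType} {P : probability Omega R}.
Implicit Types (theta : R -> Omega -> Omega) (F : R -> R -> set (set Omega)).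
Implicit Types (Phi : R -> Omega -> borel X -> borel X).

Lemma cocycle_measurable {theta F Phi} {t : R} :
  cocycle P theta F Phi -> 0 <= t ->
  measurable_fun setT (fun z : Omega * borel X => Phi t z.1 z.2).
Proof.
move=> [mPhi _ _] t0.
pose D := [set z : measurableTypeR R * Omega * borel X | 0 <= z.1.1 :> R].
have mD : measurable D.
  have -> : D = setT `&` (fst \o fst) @^-1` `[0, +oo[%classic.
    by rewrite setTI; apply/seteqP; split=> z; rewrite /D/= in_itv/= andbT.
  have mfst : measurable_fun setT
      (fun z : measurableTypeR R * Omega * borel X => z.1.1).
    exact: measurableT_comp measurable_fst measurable_fst.
  by apply: mfst => //; exact: measurable_itv.
(* Joint measurability is given only on nonnegative times; this section at the fixed time [t] takes
   its values in [D]. *)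
pose g (z : Omega * borel X) : measurableTypeR R * Omega * borel X :=
  (t : measurableTypeR R, z.1, z.2).
have mg : measurable_fun setT g.
  apply: measurable_fun_pair => //.
  by apply: measurable_fun_pair => //; exact: measurable_fst.
by apply: (measurable_comp mD _ mPhi mg) => _ [z _ <-].
Qed.

Lemma semigroup_indic {theta F Phi} {t : R} {Gamma : set (borel X)} x :
  cocycle P theta F Phi -> 0 <= t -> measurable Gamma ->
  semigroup P Phi t \1_Gamma x = transition P Phi t x Gamma.
Proof.
move=> cPhi t0 mG.
have mx : measurable_fun setT (fun w => Phi t w x).
  exact: measurableT_comp (cocycle_measurable cPhi t0)
    (pair2_measurable x).
(* Both integrals are the same by conversion, but the pushforward is known to be a measure, which
   opens the way to the change of variables. *)
transitivity (\int[pushforward P (fun w => Phi t w x)]_y (\1_Gamma y)%:E)%E.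
  by [].
rewrite ge0_integral_pushforward//; last exact/measurable_EFinP.
rewrite preimage_setT.
rewrite (integral_indic P measurableT (A := (fun w => Phi t w x) @^-1` Gamma)).
  by rewrite setIT.
by rewrite -[_ @^-1` _]setTI; exact: mx.
Qed.

(** These are the measures of the sections of one measurable subset of the product, so the
    measurability half of Tonelli's theorem applies. *)
Lemma measurable_transition {theta F Phi} {t : R} {Gamma : set (borel X)} :
  cocycle P theta F Phi -> 0 <= t -> measurable Gamma ->
  measurable_fun setT (fun x => transition P Phi t x Gamma).
Proof.
move=> cPhi t0 mG.
have mA : measurable [set z : Omega * borel X | Gamma (Phi t z.1 z.2)].
  by rewrite -[X in measurable X]setTI;
    exact: (cocycle_measurable cPhi t0 measurableT _ mG).
have := measurable_fun_ysection P mA.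
congr measurable_fun; apply/funext => x /=; congr (P _).
by apply/seteqP; split=> w; rewrite /ysection/= inE.
Qed.

End cocycle_measurability.

Lemma periodic_measure_intmul {R : realType} {d : measure_display}
    {Omega : measurableType d} {X : ptopologicalType} {P : probability Omega R}
    {Phi : R -> Omega -> borel X -> borel X} {tau : R}
    {rho : R -> set (borel X) -> \bar R} :
  periodic_measure P Phi tau rho ->
  forall (k : int) (s : R) (Gamma : set (borel X)), measurable Gamma ->
    rho (s + k%:~R * tau) Gamma = rho s Gamma.
Proof.
move=> prho.
have pos (n : nat) s Gamma : measurable Gamma ->
    rho (s + n%:R * tau) Gamma = rho s Gamma.
  move=> mG; elim: n => [|n IH]; first by rewrite mul0r addr0.
  by rewrite -IH -[in LHS]natr1 mulrDl mul1r addrA (prho _ _ mG).2.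
case=> n s Gamma mG; first exact: pos.
by rewrite NegzE mulrNz mulNr -(pos n.+1 _ _ mG) subrK.
Qed.

Theorem theorem3p6 (R : realType)
  (d : measure_display) (Omega : measurableType d) (P : probability Omega R)
  (X : ptopologicalType) (polishX : polish_space R X)
  (theta : R -> Omega -> Omega) (F : R -> R -> set (set Omega))
  (fdsF : filtered_dynamical_system P theta F)
  (Phi : R -> Omega -> borel X -> borel X)
  (markovPhi : markovian_cocycle P theta F Phi)
  (tau : R) (tau_gt0 : 0 < tau)
  (Y : R -> Omega -> borel X)
  (pathY : random_periodic_path P theta Phi tau Y)
  (adaptedY : adapted F Y)
  (ergodicY : PS_ergodic P Phi tau (law P Y))
  (s : R) (Gamma : set (borel X))
  (GammaI : invariant_sets P Phi tau (law P Y s) Gamma) :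
  {ae P, forall w, path_orbit tau Y s w `&` Gamma = set0} \/
  {ae P, forall w, path_orbit tau Y s w `<=` Gamma}.
Proof.
have [cPhi _] := markovPhi; have [mY _] := pathY.
have [mG GI] := GammaI; have [periodicY ergY] := ergodicY.
have tau0 := ltW tau_gt0.
have mYs u : measurable_fun setT (Y u).
  exact: measurableT_comp mY (pair1_measurable (u : measurableTypeR R)).
have lawE := periodic_measure_intmul periodicY.
(* Ergodicity is assumed only for times in [[0, tau)], so whole periods are removed from [s]. *)
pose m := Num.floor (s / tau); pose s0 := s - m%:~R * tau.
have s0E : s = s0 + m%:~R * tau by rewrite /s0 subrK.
have s0_itv : 0 <= s0 < tau.
  have /andP[lo hi] := floor_itv (s / tau).
  rewrite /s0 subr_ge0 -ler_pdivlMr// lo /= ltrBlDl.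
  by rewrite -[X in _ + X]mul1r -mulrDl -ltr_pdivrMr// -intrD1.
have law01 : law P Y s Gamma = 0%E \/ law P Y s Gamma = 1%E.
  rewrite s0E lawE//.
  (* Bundling [Y s0] with its measurability presents [law P Y s0] as the measure
     [distribution P Z]. *)
  pose Z : {mfun Omega >-> borel X} :=
    mfun_Sub (mem_set (mYs s0)).
  apply: (@ergodic_invariant_measure_01 _ _ _ (distribution P Z)
    (transition P Phi tau) Gamma) => //.
  - exact: ergY.
  - move=> x; rewrite -/(semigroup P Phi tau \1_Gamma x).
    by rewrite (semigroup_indic _ cPhi).
  - have := measurable_transition cPhi tau0 mG.
    congr measurable_fun; apply/funext => x.
    by rewrite -(semigroup_indic _ cPhi).
  (* The exceptional set is null for the law at [s]; periodicity makes it null for the law at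
     [s0]. *)
  - have [N [mN N0 subN]] := GI; exists N; split=> //.
    by rewrite -[LHS](lawE m s0 N mN) -s0E.
have preY u (A : set (borel X)) : measurable A -> measurable (Y u @^-1` A).
  by move=> mA; rewrite -[_ @^-1` _]setTI; exact: mYs.
have orbit_ae (A : set (borel X)) : measurable A -> law P Y s A = 0%E ->
    {ae P, forall w, path_orbit tau Y s w `&` A = set0}.
  move=> mA A0.
  (* The integers are enumerated through [unpickle], so that countably many null sets are discarded
     at once; numbers coding no integer impose nothing. *)
  have aeA : {ae P, forall w (n : nat) (k : int),
      unpickle n = Some k -> ~ A (Y (s + k%:~R * tau) w)}.
    apply: ae_foralln => n; case: (unpickle n) => [k|]; last by apply: aeW.
    exists (Y (s + k%:~R * tau) @^-1` A); split; first exact: preY.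
      by rewrite -A0 -(lawE k).
    by move=> w /= /existsNP[k'] /not_implyP[[<-]] /contrapT.
  apply: filterS aeA => w Aw; rewrite -subset0 => _ [[k _ <-]].
  exact: (Aw (pickle k) k (pickleK k)).
(* When the law gives [Gamma] full mass, the orbit almost surely avoids the null complement of
   [Gamma], that is, it stays inside [Gamma]. *)
case: law01 => [G0|G1]; [left; exact: orbit_ae|right].
have : {ae P, forall w, path_orbit tau Y s w `&` ~` Gamma = set0}.
  apply: orbit_ae; first exact: measurableC.
  rewrite /law /pushforward preimage_setC probability_setC; last exact: preY.
  by move: G1; rewrite /law /pushforward => ->; rewrite subee.
by apply: filterS => w; rewrite -[Y in _ -> _ `<=` Y]setCK => /disjoints_subset.
Qed.
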